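(* Consider a stationary $GI/GI/1$ queue with load $\rho<1$ and light-tailed service times distributed as $B$, and let $x_B=\sup\{x:\mathbb{P}\{B>x\}>0\}$ be the right endpoint of the service-time distribution. If $0<\mathbb{P}\{B=x_B\}<1$, then $$\gamma_p<\gamma_v<\gamma_w,$$ where $\gamma_v$ is the decay rate of the steady-state sojourn time $V_{SRPT}$ under the preemptive shortest remaining processing time (SRPT) discipline, $\gamma_p$ is the decay rate of the busy period $P$, and $\gamma_w$ is the decay rate of the steady-state workload $W$ seen by an arriving customer.
   Context: Queue: single server working at unit speed; i.i.d. inter-arrival times distributed as $A$ and, independently, i.i.d. service times distributed as $B$. Standing assumptions: $\rho=\mathbb{E}\{B\}/\mathbb{E}\{A\}<1$; $\mathbb{P}\{B>A\}>0$; $B$ is light-tailed, i.e. $\mathbb{E}\{e^{sB}\}$ is finite for $s$ in a neighborhood of $0$. Under preemptive SRPT, priority is always given to the customer with the smallest remaining service time. The decay rate of a random variable $U$ is the number $\gamma_u$ with $\log\mathbb{P}\{U>x\}=-\gamma_u x+o(x)$ as $x\to\infty$. With $\Phi_X(s)=\mathbb{E}\{e^{sX}\}$ and $\Phi_X^{-1}$ the inverse function of $\Phi_X$, these decay rates are given by: $\gamma_w=\sup\{s:\Phi_A(-s)\Phi_B(s)\le1\}$; $\gamma_p=\sup_{s\ge0}\{s-\Psi(s)\}$ with $\Psi(s)=-\Phi_A^{-1}(1/\Phi_B(s))$; $\gamma_v=\sup_{s\in[0,\gamma_w]}\{s-\Psi_1(s)\}$ with $\Psi_1(s)=-\Phi_{A_1}^{-1}(1/\Phi_{B_1}(s))$,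 where $\mathbb{P}\{B_1\le x\}=\mathbb{P}\{B\le x\mid B<x_B\}$ and $\Phi_{A_1}(s)=\frac{p\Phi_A(s)}{1-(1-p)\Phi_A(s)}$ with $p=\mathbb{P}\{B<x_B\}$.
   Formalization: Service times are assumed strictly positive: if B takes only the values 0 and x_B, then B_1=0, Psi_1=0 and gamma_v=gamma_w, so the strict inequality fails; other queues with zero service times reduce to the positive case by deleting those customers. *)

(* Defs.v *)
From HB Require Import structures.
From mathcomp Require Import all_boot all_order all_algebra.
From mathcomp Require Import all_classical all_reals all_analysis.
Import Order.TTheory GRing.Theory Num.Theory.
Import numFieldNormedType.Exports.

Set Implicit Arguments.
Unset Strict Implicit.
Unset Printing Implicit Defensive.

Local Open Scope classical_set_scope.
Local Open Scope ring_scope.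

(** Sample paths of a single-server queue with unit service speed.
    Customer 0 arrives at time 0 in an empty system; [a n] is the time between
    the arrivals of customers [n] and [n.+1], [b n] is the service time of
    customer [n]. *)
Section sample_path.
Context {R : realType}.
Implicit Types (a b r : nat -> R).

Definition arrival_time a (n : nat) : R := \sum_(k < n) a k.

(* Lindley's recursion: workload found by customer [n] upon arrival. *)
Fixpoint workload a b (n : nat) : R :=
  if n is m.+1 then Num.max 0 (workload a b m + b m - a m) else 0.

(* First time at which the work in the system vanishes: no work arrives between
   customers [n] and [n.+1], so the server runs out of work in that interval iff
   [workload a b n + b n <= a n].  It is [+oo] if the system never empties. *)
Definition busy_period a b : \bar R :=
  ereal_inf [set (arrival_time a n + (workload a b n + b n))%:E
            | n in [set n | workload a b n + b n <= a n]].

(* [r j] is the remaining service time of customer [j], for [j <= n].  Total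
   work having priority over customer [i]: SRPT, ties in order of arrival. *)
Definition work_ahead r (n i : nat) : R :=
  \sum_(j < n.+1 | (r j < r i) || ((r j == r i) && (j < i)%N)) r j.

(* Remaining service time of [i] after [t] time units without arrivals.  Serving
   only lowers the remaining time of the customer of highest priority, so the
   priority order is constant until the next arrival, and [i] receives service
   once the work ahead of it is exhausted. *)
Definition srpt_serve r (n : nat) (t : R) (i : nat) : R :=
  r i - Num.min (r i) (Num.max 0 (t - work_ahead r n i)).

(* Remaining service times just after the arrival of customer [n]. *)
Fixpoint srpt_remaining a b (n : nat) : nat -> R :=
  if n is m.+1 then
    fun i => if i == m.+1 then b m.+1
             else srpt_serve (srpt_remaining a b m) m (a m) i
  else fun i => if i == 0%N then b 0%N else 0.

(* Time from the arrival of customer [i] until its remaining service time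
   is 0; the instants from its arrival on are [arrival_time a n + u] with
   [i <= n] and [0 <= u <= a n]. *)
Definition srpt_sojourn a b (i : nat) : \bar R :=
  ereal_inf [set v | exists (n : nat) (u : R),
    [/\ (i <= n)%N, 0 <= u <= a n,
        srpt_serve (srpt_remaining a b n) n u i = 0 &
        v = (arrival_time a n + u - arrival_time a i)%:E]].

End sample_path.

Section stochastic.
Context {d : measure_display} {T : measurableType d} {R : realType}.
Variable P : probability T R.

(* Mutual independence: product rule over every finite subfamily. *)
Definition mutually_independent (I : eqType) (X : I -> {RV P >-> R}) : Prop :=
  forall (s : seq I) (E : I -> set R), uniq s ->
    (forall i, measurable (E i)) ->
    P (\bigcap_(i in [set` s]) (X i @^-1` E i)) =
    (\prod_(i <- s) P (X i @^-1` E i))%E.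

Definition identically_distributed (X : nat -> {RV P >-> R}) : Prop :=
  forall (n : nat) (E : set R), measurable E ->
    P (X n @^-1` E) = P (X 0%N @^-1` E).

(* [X] has the steady-state law of [U]: convergence in distribution. *)
Definition steady_state (U : nat -> T -> \bar R) (X : {RV P >-> R}) : Prop :=
  forall x : R, {for x, continuous (cdf X)} ->
    P [set w | (U n w <= x%:E)%E] @[n --> \oo] --> cdf X x.

(* [log P{U > x} = - g x + o(x)]; positivity of the tail must be explicit since
   [ln 0 = 0]. *)
Definition decay_rate (U : T -> \bar R) (g : R) : Prop :=
  (forall x : R, (0 < P [set w | (x%:E < U w)%E])%E) /\
  (ln (fine (P [set w | (x%:E < U w)%E])) + g * x) / x @[x --> +oo] --> 0.

Section formulas.
Local Open Scope ereal_scope.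
Variables A B : {RV P >-> R}.

Definition load : \bar R := 'E_P[B] / 'E_P[A].

Definition light_tailed : Prop :=
  exists2 e : R, (0 < e)%R &
    forall s : R, (`|s| < e)%R -> 'M_P B s < +oo.

(* Right endpoint of the law of [B]. *)
Definition right_endpoint : \bar R :=
  ereal_sup [set x%:E | x in [set x : R | 0 < P [set w | (x < B w)%R]]].

Local Notation xB := right_endpoint.

(* Inverse of a moment generating function.  For a nonnegative variable that is
   not a.s. 0 the set has at most one point; the value is [-oo] when [y] is not
   attained. *)
Definition mgf_inv (Phi : R -> \bar R) (y : \bar R) : \bar R :=
  ereal_sup [set s%:E | s in [set s : R | Phi s = y]].

Definition Psi (s : R) : \bar R := - mgf_inv ('M_P A) ('M_P B s)^-1.

(* The law [P{B in . | B < xB}] of [B_1] and its moment generating function. *)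
Definition law_B1 (E : set R) : \bar R :=
  P ((B @^-1` E) `&` [set w | (B w)%:E < xB]) / P [set w | (B w)%:E < xB].

Definition mgf_B1 (s : R) : \bar R := \int[law_B1]_x (expR (s * x))%:E.

(* [A_1] is a geometric sum of copies of [A]; its moment generating function
   [\sum_(n >= 1) p (1 - p)^(n-1) Phi_A^n] is infinite unless
   [(1 - p) Phi_A < 1]. *)
Definition mgf_A1 (s : R) : \bar R :=
  let p := P [set w | (B w)%:E < xB] in
  if (1 - p) * 'M_P A s < 1
  then p * 'M_P A s / (1 - (1 - p) * 'M_P A s)
  else +oo.

Definition Psi1 (s : R) : \bar R := - mgf_inv mgf_A1 (mgf_B1 s)^-1.

Definition gamma_w : \bar R :=
  ereal_sup [set s%:E | s in [set s : R | 'M_P A (- s)%R * 'M_P B s <= 1]].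

Definition gamma_p : \bar R :=
  ereal_sup [set s%:E - Psi s | s in [set s : R | (0 <= s)%R]].

Definition gamma_v : \bar R :=
  ereal_sup [set s%:E - Psi1 s | s in [set s : R | 0 <= s%:E <= gamma_w]].

End formulas.
End stochastic.

(* Main.v *)
(** Write [F u = E exp (- u A)], [M s = E exp (s B)], [q = P (B = x_B)] and
    [G s = M s - q (exp (s x_B) - 1)].  Clearing denominators, the equation
    [Phi_{A_1} (- u) Phi_{B_1} s = 1] becomes [F u G s = 1], so that
      [gamma_p = sup {s - u : F u M s = 1}],
      [gamma_v = sup {s - u : F u G s = 1, s <= gamma_w}].
    As [G] is bounded away from [1] on [[gamma_w / 2, gamma_w]], so is [u] from
    [0] there, whence [gamma_v < gamma_w].  Conversely, the pairs with
    [F u M s = 1] and [s - u >= gamma_p / 2 > 0] satisfy [F s M s <= 1], i.e.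
    [s <= gamma_w]; since [M - G] is bounded below for such [s], replacing [M] by
    [G] decreases [u] by a fixed amount, whence [gamma_p < gamma_v].  The load
    condition is what makes [gamma_p] positive. *)
Require Import Defs.
From HB Require Import structures.
From mathcomp Require Import all_boot all_order all_algebra.
From mathcomp Require Import all_classical all_reals all_analysis.
From mathcomp Require Import measurable_realfun.
From mathcomp Require Import ring lra.
Import Order.TTheory GRing.Theory Num.Theory.
Import numFieldNormedType.Exports.

Local Open Scope classical_set_scope.
Local Open Scope ring_scope.

(** * Gaps between the solutions of [F u G s = 1] and [F u M s = 1] *)

Section laplace_like.
Context {R : realType}.
Variable F : R -> R.
Hypothesis F0 : F 0 = 1.
Hypothesis F_nincr : forall u v : R, 0 <= u -> u <= v -> F v <= F u.
(* A modulus of continuity for [F u = E exp (- u A)]; there is no Lipschitz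
   bound at [0] when [E A] is infinite. *)
Hypothesis F_modulus : forall u v : R,
  0 <= u -> u <= v -> F u - F v <= 1 - F (v - u).
Hypothesis F_right0 : forall e : R,
  0 < e -> exists2 d : R, 0 < d & (1 : R) - F d < e.

Lemma ivt_of_modulus (u y : R) : 0 <= u -> F u <= y -> y <= 1 ->
  exists2 v : R, 0 <= v <= u & F v = y.
Proof.
(* The hypotheses on [F] concern [[0, +oo[] only; its even extension is continuous on the whole
   line. *)
move=> u0 Fuy y1; pose g (v : R) := F `|v|.
have gE v : 0 <= v -> g v = F v by move=> v0; rewrite /g ger0_norm.
have g_le v w : `|v| <= `|w| -> `|g v - g w| <= 1 - F `|v - w|.
  move=> vw; rewrite ger0_norm ?subr_ge0 ?F_nincr//.
  apply: (le_trans (F_modulus _ _ _ vw)) => //.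
  rewrite lerD2l lerN2 F_nincr ?subr_ge0// distrC.
  by apply: le_trans (ler_norm _) _; exact: ler_dist_dist.
have gc : continuous g.
  move=> v; apply/cvgrPdist_lt => e e0.
  have [d d0 Fd] := F_right0 _ e0.
  near=> w.
  have vw : `|v - w| < d.
    by near: w; apply: (@cvgr_dist_lt _ _ _ _ _ _ _ cvg_id).
  apply: le_lt_trans Fd.
  suff h : `|g v - g w| <= 1 - F `|v - w|.
    by apply: le_trans h _; rewrite lerD2l lerN2 F_nincr// ltW.
  have [vw'|wv] := leP `|v| `|w|; first exact: g_le.
  by rewrite distrC (distrC v); apply: g_le; exact: ltW.
have [|v vu <-] := @IVT _ g 0 u y u0 (continuous_subspaceT gc).
  by rewrite !gE// F0 min_r ?max_l ?F_nincr ?Fuy// -F0 F_nincr.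
move: vu; rewrite in_itv /= => vu; exists v => //.
by rewrite gE//; case/andP: vu.
Unshelve. all: by end_near. Qed.

(** Otherwise monotonicity and the modulus would give [F u - F v <= 1 - F d < e]. A drop in the
    values of [F] thus becomes a distance between arguments. *)
Lemma ler_of_gap (u v e d : R) :
  0 <= u -> 0 <= v -> 0 < d -> (1 : R) - F d < e ->
  e <= F u - F v -> d <= v - u.
Proof.
move=> u0 v0 d0 Fd euv; rewrite leNgt; apply/negP => vud.
have [uv|/ltW vu] := leP u v.
  have := F_modulus _ _ u0 uv.
  have : F d <= F (v - u) by rewrite F_nincr ?subr_ge0// ltW.
  lra.
have := F_nincr _ _ v0 vu.
have : F d <= F 0 by rewrite F_nincr// ltW.
by rewrite F0; lra.
Qed.

(** * Uniform gaps for abstract [G] and [M = G + c] *)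

Section gaps.
Variables (G M : R -> R) (gw : R).
Hypothesis G_gt0 : forall s : R, 0 <= s -> 0 < G s.
Hypothesis G_ndecr : forall s t : R, 0 <= s -> s <= t -> G s <= G t.
Hypothesis G_gt1 : forall s : R, 0 < s -> 1 < G s.
Hypothesis gw_gt0 : 0 < gw.

Lemma sojourn_workload_gap : exists2 d : R, 0 < d &
  forall s u : R, 0 <= s <= gw -> 0 <= u -> F u * G s = 1 -> s - u <= gw - d.
Proof.
have g20 : 0 < gw / 2 by rewrite divr_gt0.
have G1 := G_gt1 _ g20.
have Gi : 0 < 1 - (G (gw / 2))^-1.
  by rewrite subr_gt0 invf_lt1// (lt_trans _ G1).
have [d d0 Fd] := F_right0 _ Gi.
exists (Num.min d (gw / 2)); first by rewrite lt_min d0.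
move=> s u /andP[s0 sg] u0 FG.
have m1 : Num.min d (gw / 2) <= gw / 2 by rewrite ge_min lexx orbT.
have m2 : Num.min d (gw / 2) <= d by rewrite ge_min lexx.
(* For small [s], [u >= 0] suffices. Beyond [gw / 2], [F u = 1 / G s] is at most
   [1 / G (gw / 2) < 1], which keeps [u] at least [d] away from 0. *)
have [sg2|sg2] := leP s (gw / 2); first lra.
suff : d <= u - 0 by lra.
apply: (ler_of_gap _ _ _ _ _ _ d0 Fd) => //.
rewrite F0 lerD2l lerN2.
have -> : F u = (G s)^-1.
  by rewrite -[LHS](mulfK (lt0r_neq0 (G_gt0 _ s0))) FG mul1r.
by rewrite lef_pV2 ?posrE ?G_gt0 ?G_ndecr// ltW.
Qed.

Variable c : R -> R.
Hypothesis c_gt0 : forall s : R, 0 < s -> 0 < c s.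
Hypothesis c_ndecr : forall s t : R, 0 <= s -> s <= t -> c s <= c t.
Hypothesis M_ndecr : forall s t : R, 0 <= s -> s <= t -> M s <= M t.
Hypothesis GM : forall s : R, 0 <= s -> M s = G s + c s.

Lemma busy_sojourn_gap (g : R) : 0 < g -> exists2 d : R, 0 < d &
  forall s u : R, 0 <= u -> s <= gw -> g <= s - u -> F u * M s = 1 ->
  exists2 v : R, 0 <= v <= u - d & F v * G s = 1.
Proof.
move=> g0; have Mg0 : 0 < M gw by rewrite GM ?ltr_wpDr ?G_gt0 ?ltW// c_gt0.
(* A lower bound for [1 / G s - 1 / M s = c s / (G s M s)], uniform over [g <= s <= gw]. *)
pose e := c g / M gw ^+ 2.
have e0 : 0 < e by rewrite divr_gt0 ?exprn_gt0 ?c_gt0.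
have [d d0 Fd] := F_right0 _ e0; exists d => // s u u0 sg gsu FM.
have gs : g <= s by lra.
have s0 : 0 < s by lra.
have Gs0 : 0 < G s by rewrite G_gt0// ltW.
have Ms0 : 0 < M s by rewrite GM ?addr_gt0 ?c_gt0// ltW.
have FuE : F u = (M s)^-1 by rewrite -[LHS](mulfK (lt0r_neq0 Ms0)) FM mul1r.
have cgs : c g <= c s by rewrite c_ndecr// ltW.
have MG : M s = G s + c s by rewrite GM// ltW.
have cg0 := c_gt0 _ g0.
have gap : e <= (G s)^-1 - F u.
  rewrite FuE /e.
  have -> : (G s)^-1 - (M s)^-1 = c s / (G s * M s).
    by rewrite MG; field; rewrite -MG !lt0r_neq0.
  rewrite ler_pM ?(ltW cg0)// ?invr_ge0 ?exprn_ge0 ?(ltW Mg0)//.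
  have MM : M s <= M gw by rewrite M_ndecr// ltW.
  rewrite lef_pV2 ?posrE ?exprn_gt0 ?mulr_gt0// expr2.
  by apply: ler_pM => //; [exact: ltW|exact: ltW|lra].
(* [1 / G s] lies between [F u] and [F 0 = 1], hence is attained at some [v] in [[0, u]]; the gap
   [e] then separates [v] from [u] by [d]. *)
have [||v /andP[v0 vu] Fv] := @ivt_of_modulus u (G s)^-1 u0.
- by rewrite -subr_ge0 (le_trans (ltW e0)).
- by rewrite invf_le1// ltW// G_gt1.
exists v; last by rewrite Fv mulVf// lt0r_neq0.
rewrite v0/= lerBrDr -lerBrDl.
by apply: (ler_of_gap _ _ _ _ _ _ d0 Fd) => //; rewrite Fv.
Qed.

End gaps.
End laplace_like.

(** * The Laplace transform of a nonnegative random variable *)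

Section integrals.
Context {d : measure_display} {T : measurableType d} {R : realType}.
Variable P : probability T R.

Lemma mmt_gen_funE (X : {RV P >-> R}) t :
  'M_P X t = (\int[P]_w (expR (t * X w)%R)%:E)%E.
Proof.
rewrite /mmt_gen_fun expectation.unlock; apply: eq_integral => w _ /=.
by rewrite mulrC.
Qed.

Lemma integral_probability1 : (\int[P]_w (1 : R)%:E = 1)%E.
Proof. by rewrite integral_cst// mul1e; exact: probability_setT. Qed.

Lemma measurable_expRM (X : {RV P >-> R}) (t : R) (D : set T) :
  measurable_fun D (EFin \o (fun w => expR (t * X w))).
Proof.
apply/measurable_EFinP; apply: measurable_funTS.
apply: measurableT_comp => //; exact: measurable_funM.
Qed.

(** Monotone convergence: [f s] increases to [f 0] as [s] runs down the sequence [1 / (n + 1)], and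
    exceeding [c] is an open condition on the limit. *)
Lemma near_harmonic_integral_gt (f : R -> T -> R) (c : R) :
  (forall s, measurable_fun setT (f s)) ->
  (forall s w, 0 <= s -> 0 <= f s w) ->
  (forall w (s t : R), 0 <= s -> s <= t -> f t w <= f s w) ->
  (forall w, {for 0, continuous (f ^~ w)}) ->
  (c%:E < \int[P]_w (f 0 w)%:E)%E ->
  \forall n \near \oo, (c%:E < \int[P]_w (f (harmonic n) w)%:E)%E.
Proof.
move=> mf f0 fle fc cf.
have h0 n : (0 : R) <= harmonic n by exact: harmonic_ge0.
have limE w : limn (fun n => (f (harmonic n) w)%:E) = (f 0 w)%:E.
  apply/cvg_lim => //; apply/fine_cvgP; split; first exact: nearW.
  rewrite -[X in _ --> X]/(fine (f 0 w)%:E).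
  apply: (@cvg_comp _ _ _ (@harmonic R) (f ^~ w) _ _ _ (@cvg_harmonic R)).
  exact: fc.
have := @cvg_monotone_convergence _ _ _ P _ measurableT
  (fun n w => (f (harmonic n) w)%:E).
rewrite (eq_integral _ _ (fun w _ => limE w)) => H.
have : (fun n => \int[P]_w (f (harmonic n) w)%:E)%E x @[x --> \oo] -->
   (\int[P]_w (f 0 w)%:E)%E.
  apply: H => [n|n w _|w _ m n mn].
  - by apply/measurable_EFinP.
  - by rewrite lee_fin f0.
  - rewrite lee_fin fle// /harmonic/= lef_pV2 ?posrE ?ltr0n//.
    by rewrite ler_nat ltnS.
move/(_ [set y | (c%:E < y)%E]); apply.
by apply: open_nbhs_nbhs; split => //; exact: open_ereal_gt_ereal.
Qed.


(** A zero integral would make [X] vanish almost everywhere on [D], so [D] would be negligible. *)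
Lemma integral_pos_gt0 (X : {RV P >-> R}) (D : set T) : measurable D ->
  (forall w, D w -> 0 < X w) -> (0 < P D)%E ->
  (0 < \int[P]_(w in D) (X w)%:E)%E.
Proof.
move=> mD X0 PD; rewrite lt0e integral_ge0 => [|w Dw]; last first.
  by rewrite lee_fin ltW// X0.
rewrite andbT; apply/eqP => I0.
have mX : measurable_fun D (EFin \o X).
  by apply/measurable_EFinP; exact: measurable_funTS.
have : (\int[P]_(w in D) `|(X w)%:E| = 0)%E.
  rewrite -I0; apply: eq_integral => w /[!inE] Dw.
  by rewrite gee0_abs// lee_fin ltW// X0.
move/(ae_eq_integral_abs P mD mX) => [N [mN N0 subN]].
move: PD; rewrite lt_neqAle => /andP[/eqP + _]; apply.
apply/esym/eqP; rewrite eq_le measure_ge0 andbT -N0.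
apply: le_measure; rewrite ?inE//.
move=> w Dw; apply: subN => /= /(_ Dw) [] Xw.
by have := X0 _ Dw; rewrite Xw ltxx.
Qed.

(** * Regularity of [E exp (- u X)] and its behaviour near 0 *)

Section laplace_transform.
Variable X : {RV P >-> R}.
Hypothesis X_ge0 : forall w, 0 <= X w.

Definition laplace (u : R) : R := fine ('M_P X (- u)).

Lemma laplaceE u : 0 <= u -> ('M_P X (- u) = (laplace u)%:E)%E.
Proof.
move=> u0; rewrite fineK// ge0_fin_numE; last first.
  by rewrite mmt_gen_funE integral_ge0// => w _; rewrite lee_fin expR_ge0.
rewrite mmt_gen_funE; apply: (@le_lt_trans _ _ 1%E); last exact: ltry.
rewrite -integral_probability1.
apply: ge0_le_integral => //.
- exact: measurable_expRM.
- by move=> w _; rewrite lee_fin -[leRHS]expR0 ler_expR mulNr oppr_le0 mulr_ge0.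
Qed.

Lemma laplace0 : laplace 0 = 1.
Proof.
rewrite /laplace mmt_gen_funE oppr0.
under eq_integral do rewrite mul0r expR0.
by rewrite integral_probability1.
Qed.

Lemma laplace_nincr u v : 0 <= u -> u <= v -> laplace v <= laplace u.
Proof.
move=> u0 uv; have v0 := le_trans u0 uv.
rewrite -lee_fin -!laplaceE// !mmt_gen_funE; apply: ge0_le_integral => //.
- exact: measurable_expRM.
- exact: measurable_expRM.
- by move=> w _; rewrite lee_fin ler_expR ler_wpM2r// lerN2.
Qed.

(** This is the expectation of [(1 - exp (- u X)) (1 - exp (- (v - u) X)) >= 0], rearranged into
    sums of nonnegative integrals. *)
Lemma laplace_modulus u v : 0 <= u -> u <= v ->
  laplace u - laplace v <= 1 - laplace (v - u).
Proof.
move=> u0 uv; have v0 := le_trans u0 uv.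
have vu0 : 0 <= v - u by rewrite subr_ge0.
suff : laplace u + laplace (v - u) <= laplace 0 + laplace v.
  by rewrite laplace0; lra.
rewrite -lee_fin !EFinD -!laplaceE// !mmt_gen_funE -!ge0_integralD//;
  try (by move=> w _; rewrite lee_fin expR_ge0); try exact: measurable_expRM.
apply: ge0_le_integral => //.
- by move=> w _; rewrite adde_ge0// lee_fin expR_ge0.
- by apply: emeasurable_funD; exact: measurable_expRM.
- by apply: emeasurable_funD; exact: measurable_expRM.
move=> w _; rewrite -!EFinD lee_fin oppr0 mul0r expR0.
have -> : - v * X w = - u * X w + - (v - u) * X w by ring.
rewrite expRD.
have e1 t : 0 <= t -> expR (- t * X w) <= 1.
  by move=> t0; rewrite -expR0 ler_expR mulNr oppr_le0 mulr_ge0.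
have := e1 _ u0; have := e1 _ vu0; nra.
Qed.

Lemma laplace_right0 (e : R) : 0 < e -> exists2 s, 0 < s & 1 - laplace s < e.
Proof.
move=> e0.
have [|||||N _ /(_ N (leqnn _))] := near_harmonic_integral_gt
  (fun s w => expR (- s * X w)) (1 - e).
- by move=> s; exact/measurable_EFinP/measurable_expRM.
- by move=> *; exact: expR_ge0.
- by move=> w s t s0 st; rewrite ler_expR ler_wpM2r// lerN2.
- move=> w; apply: continuous_comp; last exact: continuous_expR.
  by apply: cvgM; [exact: opp_continuous|exact: cvg_cst].
- rewrite -mmt_gen_funE laplaceE// laplace0 lte_fin; lra.
rewrite -mmt_gen_funE laplaceE ?harmonic_ge0// lte_fin => h.
exists (harmonic N); first exact: harmonic_gt0.
lra.
Qed.

(** From [exp y >= 1 + y], the value is at least [1 + t E X], where [E X] may be infinite. *)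
Lemma mmt_gen_fun_gt1 t : (0 < 'E_P[X])%E -> 0 < t -> (1 < 'M_P X t)%E.
Proof.
rewrite expectation.unlock mmt_gen_funE => EX t0.
have mX : measurable_fun setT (EFin \o X) by exact/measurable_EFinP.
apply: (@lt_le_trans _ _ (1 + t%:E * \int[P]_w (X w)%:E)%E).
  by rewrite lteDl// mule_gt0.
have t0' := ltW t0.
rewrite -ge0_integralZl//; last by move=> w _; rewrite lee_fin.
rewrite -integral_probability1.
rewrite -ge0_integralD//; last 2 first.
- by move=> w _; rewrite mule_ge0// lee_fin// ltW.
- exact: measurable_funeM.
apply: ge0_le_integral => //.
- by move=> w _; rewrite adde_ge0// mule_ge0// lee_fin// ltW.
- by apply: emeasurable_funD => //; exact: measurable_funeM.
- exact: measurable_expRM.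
- by move=> w _; rewrite -EFinM -EFinD lee_fin expR_ge1Dx.
Qed.

(* [(1 + y) exp (- y) <= 1] for [y = s X], and [X exp (- s X)] increases to [X]
   as [s] decreases to 0. *)
Lemma laplace_slope (c : R) : (c%:E < 'E_P[X])%E ->
  \forall n \near \oo, laplace (harmonic n) <= 1 - harmonic n * c.
Proof.
rewrite expectation.unlock => cX.
pose f (s : R) w := X w * expR (- s * X w).
have mf s : measurable_fun setT (f s).
  by apply: measurable_funM => //; exact/measurable_EFinP/measurable_expRM.
have f_ge0 s w : 0 <= f s w by rewrite mulr_ge0// expR_ge0.
have f0E : (\int[P]_w (f 0 w)%:E = \int[P]_w (X w)%:E)%E.
  by apply: eq_integral => w _; rewrite /f oppr0 mul0r expR0 mulr1.
have : \forall n \near \oo, (c%:E < \int[P]_w (f (harmonic n) w)%:E)%E.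
  apply: near_harmonic_integral_gt => //; last by rewrite f0E.
    by move=> w s t s0 st; rewrite ler_wpM2l// ler_expR ler_wpM2r// lerN2.
  move=> w; apply: cvgM; first exact: cvg_cst.
  apply: continuous_comp; last exact: continuous_expR.
  by apply: cvgM; [exact: opp_continuous|exact: cvg_cst].
apply: filterS => n cf.
have s0 : 0 < harmonic n :> R by exact: harmonic_gt0.
move: (harmonic n) s0 cf => s s0 cf; have s0' := ltW s0.
rewrite lerBrDr -lee_fin EFinD EFinM -laplaceE// mmt_gen_funE.
apply: (@le_trans _ _ (\int[P]_w (expR (- s * X w))%:E
                       + s%:E * \int[P]_w (f s w)%:E)%E).
  by rewrite leeD2l// lee_pmul2l// ltW.
have mfE : measurable_fun setT (EFin \o f s) by exact/measurable_EFinP.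
rewrite -ge0_integralZl//; last by move=> w _; rewrite lee_fin.
rewrite -ge0_integralD//; first last.
- exact: measurable_funeM.
- by move=> w _; rewrite mule_ge0// lee_fin// ltW.
- exact: measurable_expRM.
rewrite -integral_probability1.
apply: ge0_le_integral => //.
- by move=> w _; rewrite adde_ge0// ?mule_ge0// lee_fin ?expR_ge0// ltW.
- apply: emeasurable_funD; first exact: measurable_expRM.
  exact: measurable_funeM.
move=> w _; rewrite -EFinM -EFinD lee_fin /f mulrA mulNr expRN.
rewrite -[X in X + _]mul1r -mulrDl ler_pdivrMr ?expR_gt0// mul1r.
exact: expR_ge1Dx.
Qed.

End laplace_transform.
End integrals.

(** * Random variables with an atom at their right endpoint *)

Section atom.
Context {d : measure_display} {T : measurableType d} {R : realType}.
Variables (P : probability T R) (B : {RV P >-> R}) (x : R).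
Hypothesis B_gt0 : forall w, 0 < B w.
Hypothesis xE : right_endpoint B = x%:E.

Let D := [set w | B w < x].
Let E := [set w | B w = x].
Let N := [set w | x < B w].

Lemma measurable_rv_lt (c : R) : measurable [set w | B w < c].
Proof.
rewrite (_ : mkset _ = B @^-1` `]-oo, c[); last first.
  by apply/seteqP; split => w /=; rewrite in_itv.
exact: measurable_funPTI.
Qed.

Lemma measurable_rv_gt (c : R) : measurable [set w | c < B w].
Proof.
rewrite (_ : mkset _ = B @^-1` `]c, +oo[); last first.
  by apply/seteqP; split => w /=; rewrite in_itv/= andbT.
exact: measurable_funPTI.
Qed.

Lemma measurable_rv_eq (c : R) : measurable [set w | B w = c].
Proof.
rewrite (_ : mkset _ = B @^-1` [set c])//; exact: measurable_funPTI.
Qed.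

Lemma integral_cst_fine (C : set T) (c : R) : measurable C ->
  (\int[P]_(w in C) c%:E = (c * fine (P C))%:E)%E.
Proof. by move=> mC; rewrite integral_cst// EFinM fineK// fin_num_measure. Qed.

Let mD : measurable D := measurable_rv_lt x.
Let mE : measurable E := measurable_rv_eq x.
Let mN : measurable N := measurable_rv_gt x.

(** [N] is the union of the events [B > x + 1 / (n + 1)], each null because [x] is the supremum of
    the levels exceeded with positive probability. *)
Lemma above_endpoint0 : P N = 0%E.
Proof.
have NE : N = \bigcup_n [set w | x + harmonic n < B w].
  apply/seteqP; split => [w /= xB|w [n _ /=]]; last first.
    by apply: lt_trans; rewrite ltrDl harmonic_gt0.
  have xB0 : 0 < B w - x by rewrite subr_gt0.
  have [n _ /(_ n (leqnn _)) /=] := cvgr_lt _ (@cvg_harmonic R) _ xB0.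
  by rewrite ltrBrDl => ?; exists n.
apply/negligibleP => //; rewrite NE; apply: negligible_bigcup => n.
apply/negligibleP; first exact: measurable_rv_gt.
apply/eqP; rewrite eq_le measure_ge0 andbT leNgt; apply/negP => PN.
have : ((x + harmonic n)%:E <= right_endpoint B)%E.
  by apply: ereal_sup_ubound; exists (x + harmonic n).
by rewrite xE lee_fin gerDl leNgt harmonic_gt0.
Qed.

(** Up to the null event [N], the sample space splits into [D] and the atom. The cases [h = 1],
    [h y = exp (s y)] and [h y = y] give total mass, transform and mean. *)
Lemma ge0_integral_atom (h : R -> R) : (forall y, 0 <= y -> 0 <= h y) ->
  measurable_fun setT (h \o B) ->
  (\int[P]_w (h (B w))%:E =
   \int[P]_(w in D) (h (B w))%:E + (h x * fine (P E))%:E)%E.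
Proof.
move=> h0 mh.
have mhE (C : set T) : measurable_fun C (fun w => (h (B w))%:E).
  by apply/measurable_EFinP; exact: measurable_funTS.
have hB0 w : (0 <= (h (B w))%:E)%E by rewrite lee_fin h0// ltW.
rewrite (ge0_negligible_integral mN measurableT)//; last exact: above_endpoint0.
have -> : [set: T] `\` N = D `|` E.
  apply/seteqP; split => w; rewrite /D /E /N /=; first last.
    case=> [|->]; split => //; rewrite ?ltxx// => /ltW.
    by rewrite leNgt => /negP.
  by case=> _ /negP; rewrite -leNgt le_eqVlt => /orP[/eqP|]; [right|left].
rewrite ge0_integral_setU//; last first.
  apply/disj_setPS => w [] /= + Ew; rewrite /D /=.
  by rewrite Ew ltxx.
congr (_ + _)%E.
transitivity (\int[P]_(w in E) (cst (h x)%:E w))%E; last first.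
  exact: integral_cst_fine.
apply: eq_integral => w /[!inE] Ew.
by rewrite /= Ew.
Qed.

Let p := fine (P D).
Let q := fine (P E).

Lemma prob_below_endpoint : p + q = 1.
Proof.
have := ge0_integral_atom (cst 1) (fun _ _ => ler01) (measurable_cst _).
rewrite /= integral_probability1 integral_cst_fine// !mul1r -EFinD.
by case=> <-.
Qed.

(** Left unnormalised: this is [p] times the moment generating function of [B_1]. *)
Definition truncated_mgf (s : R) : R :=
  fine (\int[P]_(w in D) (expR (s * B w))%:E).
Definition truncated_mean : R := fine (\int[P]_(w in D) (B w)%:E).

Local Notation H := truncated_mgf.
Local Notation m := truncated_mean.

Let bounded_fin (f : T -> R) (c : R) : measurable_fun setT f ->
  (forall w, D w -> 0 <= f w <= c) ->
  (\int[P]_(w in D) (f w)%:E)%E \is a fin_num.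
Proof.
move=> mf fc; rewrite ge0_fin_numE; last first.
  by apply: integral_ge0 => w /fc /andP[? _]; rewrite lee_fin.
apply: (@le_lt_trans _ _ (c * p)%:E); last first.
  exact: ltry.
rewrite -integral_cst_fine//; apply: ge0_le_integral => //.
- by move=> w /fc /andP[? _]; rewrite lee_fin.
- by apply/measurable_EFinP; exact: measurable_funTS.
- by move=> w /fc /andP[_ ?]; rewrite lee_fin.
Qed.

Lemma truncated_mgfE s : 0 <= s ->
  (\int[P]_(w in D) (expR (s * B w))%:E = (H s)%:E)%E.
Proof.
move=> s0; rewrite fineK//; apply: (bounded_fin _ (expR (s * x))).
  exact/measurable_EFinP/measurable_expRM.
by move=> w /ltW Dw; rewrite expR_ge0/= ler_expR ler_wpM2l.
Qed.

Lemma truncated_meanE : (\int[P]_(w in D) (B w)%:E = m%:E)%E.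
Proof.
rewrite fineK//; apply: (bounded_fin _ x) => //.
by move=> w /ltW ->; rewrite ltW.
Qed.

Lemma mmt_gen_fun_atom s : 0 <= s -> ('M_P B s = (H s + q * expR (s * x))%:E)%E.
Proof.
move=> s0; rewrite mmt_gen_funE.
rewrite (ge0_integral_atom (fun y => expR (s * y))); first last.
- exact/measurable_EFinP/measurable_expRM.
- by move=> y _; exact: expR_ge0.
by rewrite truncated_mgfE// -EFinD mulrC.
Qed.

Lemma expectation_atom : ('E_P[B] = (m + q * x)%:E)%E.
Proof.
rewrite expectation.unlock (ge0_integral_atom id)//.
by rewrite truncated_meanE -EFinD mulrC.
Qed.

Lemma truncated_mgf_ge0 s : 0 <= H s.
Proof.
by rewrite fine_ge0// integral_ge0// => w _; rewrite lee_fin expR_ge0.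
Qed.

Lemma truncated_mgf_ndecr s t : 0 <= s -> s <= t -> H s <= H t.
Proof.
move=> s0 st; have t0 := le_trans s0 st.
rewrite -lee_fin -!truncated_mgfE//; apply: ge0_le_integral => //.
- exact: measurable_expRM.
- exact: measurable_expRM.
- by move=> w _; rewrite lee_fin ler_expR ler_wpM2r// ltW.
Qed.

Let integral_affine (k : R) : 0 <= k ->
  (\int[P]_(w in D) (1 + k * B w)%:E = (p + k * m)%:E)%E.
Proof.
move=> k0; under eq_integral do rewrite EFinD EFinM.
have mB : measurable_fun D (EFin \o B).
  by apply/measurable_EFinP; exact: measurable_funTS.
have B0 w : D w -> (0 <= (B w)%:E)%E by rewrite lee_fin ltW.
rewrite ge0_integralD//; first last.
- exact: measurable_funeM.
- by move=> w Dw; rewrite mule_ge0// B0.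
rewrite ge0_integralZl// truncated_meanE integral_cst_fine// mul1r.
by rewrite -EFinM -EFinD.
Qed.

Let measurable_affine (k : R) : measurable_fun D (fun w => (1 + k * B w)%:E).
Proof.
apply/measurable_EFinP; apply: measurable_funTS; apply: measurable_funD => //.
exact: measurable_funM.
Qed.

Lemma truncated_mgf_ge s : 0 <= s -> p + s * m <= H s.
Proof.
move=> s0; rewrite -lee_fin -truncated_mgfE// -integral_affine//.
apply: ge0_le_integral => //.
- by move=> w _; rewrite lee_fin addr_ge0// mulr_ge0// ltW.
- exact: measurable_expRM.
- by move=> w _; rewrite lee_fin expR_ge1Dx.
Qed.

Lemma expR_le1DMexpR (y : R) : expR y <= 1 + y * expR y.
Proof.
have := expR_ge1Dx (- y); rewrite -(ler_pM2r (expR_gt0 y)) expRN.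
by rewrite mulVf ?gt_eqF ?expR_gt0// mulrDl mul1r mulNr; lra.
Qed.

(** Integrates [exp y <= 1 + y exp y] at [y = s B], with [B < x] in the last exponent; to first
    order in [s] it matches the lower bound [p + s m]. *)
Lemma truncated_mgf_le s : 0 <= s -> H s <= p + s * expR (s * x) * m.
Proof.
move=> s0; have k0 : 0 <= s * expR (s * x) by rewrite mulr_ge0// expR_ge0.
rewrite -lee_fin -truncated_mgfE// -integral_affine//.
apply: ge0_le_integral => //.
- exact: measurable_expRM.
- move=> w /ltW Dw; rewrite lee_fin (le_trans (expR_le1DMexpR _))// lerD2l.
  by rewrite mulrAC ler_wpM2r ?(ltW (B_gt0 w))// ler_wpM2l// ler_expR ler_wpM2l.
Qed.

Lemma truncated_mean_gt0 : 0 < p -> 0 < m.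
Proof.
move=> p0; rewrite -lte_fin -truncated_meanE.
apply: integral_pos_gt0 => //.
by move: p0; rewrite -lte_fin fineK// fin_num_measure.
Qed.

Lemma mgf_B1E s : 0 < p -> 0 <= s -> mgf_B1 B s = (H s / p)%:E.
Proof.
move=> p0 s0; have p0' := ltW p0.
have k0 : 0 <= p^-1 by rewrite invr_ge0.
have DE : [set w | ((B w)%:E < right_endpoint B)%E] = D.
  by apply/seteqP; split => w /=; rewrite xE lte_fin.
have mB : measurable_fun setT B by [].
(* [law_B1] is a bare set function; as a scaled pushforward of [P] restricted to [D] it is a
   measure, and the change of variables applies. *)
have lawE : law_B1 B = mscale (NngNum k0) (pushforward (mrestr P mD) B).
  move=> m; apply/boolp.funext => F.
  rewrite /law_B1 DE /mscale /pushforward /mrestr /=.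
  have -> : P D = p%:E by rewrite fineK// fin_num_measure.
  by rewrite inver gt_eqF// muleC.
rewrite /mgf_B1 (lawE mB).
have me : measurable_fun setT (fun y : R => (expR (s * y))%:E).
  by apply/measurable_EFinP; apply: measurableT_comp.
rewrite ge0_integral_mscale//= ge0_integral_pushforward// preimage_setT.
have mf (C : set T) : measurable_fun C (fun w => (expR (s * B w))%:E).
  exact: measurable_expRM.
rewrite (ge0_negligible_integral (measurableC mD) measurableT)//; last 2 first.
- by move=> w _; rewrite lee_fin expR_ge0.
- by rewrite /= /mrestr setICl measure0.
rewrite setDE setCK setTI.
rewrite (eq_measure_integral P) => [|C mC CD]; last first.
  by rewrite /= /mrestr (setIidl CD).
by rewrite truncated_mgfE// -EFinM mulrC.
Qed.

End atom.

(** * The formulas for the decay rates *)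

Section formulas.
Context {d : measure_display} {T : measurableType d} {R : realType}.
Variables (P : probability T R) (A B : {RV P >-> R}) (x : R).
Hypothesis A_ge0 : forall w, 0 <= A w.
Hypothesis EA_gt0 : (0 < 'E_P[A])%E.
Hypothesis B_gt0 : forall w, 0 < B w.
Hypothesis xE : right_endpoint B = x%:E.

Local Notation F := (laplace P A).
Local Notation H := (truncated_mgf P B x).
Let p := fine (P [set w | B w < x]).
Let q := fine (P [set w | B w = x]).
Hypothesis p_gt0 : 0 < p.
Hypothesis q_gt0 : 0 < q.

(** Since [1 / g <= 1] while the moment generating function of [A] exceeds 1 at positive arguments,
    every solution has [t <= 0]. *)
Lemma mmt_gen_fun_eqV (g t : R) : 1 <= g -> 'M_P A t = (g^-1)%:E ->
  exists2 u, 0 <= u & t = - u /\ F u * g = 1.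
Proof.
move=> g1 At; have g0 : 0 < g by exact: lt_le_trans g1.
have t0 : 0 <= - t.
  rewrite oppr_ge0 leNgt; apply/negP => t0.
  have := mmt_gen_fun_gt1 P A A_ge0 t EA_gt0 t0.
  by rewrite At lte_fin ltNge invf_le1// g1.
exists (- t) => //; rewrite opprK; split => //.
by rewrite /laplace opprK At /= mulVf// lt0r_neq0.
Qed.

(** The inverse is a supremum over solutions [- u], so each may be bounded separately; without
    solutions it is [-oo] and the bound is trivial. *)
Lemma sub_mgf_inv_le (s g c : R) : 1 <= g ->
  (forall u, 0 <= u -> F u * g = 1 -> s - u <= c) ->
  (s%:E - - mgf_inv ('M_P A) (g^-1)%:E <= c%:E)%E.
Proof.
move=> g1 sc; rewrite oppeK addeC -leeBrDr// -EFinB.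
apply: ge_ereal_sup => _ [t /= At <-]; rewrite lee_fin.
have [u u0 [-> /(sc _ u0)]] := mmt_gen_fun_eqV _ _ g1 At; lra.
Qed.

Lemma le_sub_mgf_inv (s g u : R) : 0 < g -> 0 <= u -> F u * g = 1 ->
  ((s - u)%:E <= s%:E - - mgf_inv ('M_P A) (g^-1)%:E)%E.
Proof.
move=> g0 u0 Fg; rewrite oppeK EFinB leeD2l//.
apply: ereal_sup_ubound; exists (- u) => //=.
by rewrite laplaceE// -[F u](mulfK (lt0r_neq0 g0)) Fg mul1r.
Qed.

(** With [a] the transform of [A] at [t], the equation [p a / (1 - q a) = p / H s] reads
    [a H s = 1 - q a], that is [a (H s + q) = 1]. *)
Lemma mgf_A1_eq (s t : R) : 0 <= s ->
  mgf_A1 A B t = (mgf_B1 B s)^-1%E <-> 'M_P A t = ((H s + q)^-1)%:E.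
Proof.
move=> s0; have p1 : p + q = 1 by exact: prob_below_endpoint.
have Hs : 0 < H s.
  apply: lt_le_trans (truncated_mgf_ge P B x B_gt0 s s0).
  by rewrite ltr_wpDr// mulr_ge0// ltW// truncated_mean_gt0.
have G0 : 0 < H s + q by rewrite addr_gt0.
have DE : P [set w | ((B w)%:E < right_endpoint B)%E] = p%:E.
  rewrite /p fineK; last by rewrite fin_num_measure//; exact: measurable_rv_lt.
  by congr (P _); apply/seteqP; split => w /=; rewrite xE lte_fin.
rewrite (mgf_B1E P B x xE)// inver gt_eqF ?divr_gt0// invf_div.
rewrite /mgf_A1 DE -EFinB (_ : 1 - p = q); last by rewrite -p1; lra.
have : (0 <= 'M_P A t)%E.
  by rewrite mmt_gen_funE integral_ge0// => w _; rewrite lee_fin expR_ge0.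
case: ('M_P A t) => [a| |]//; last first.
  (* If the transform of [A] is infinite, so is that of [A_1], and both equations fail. *)
  by move=> _; rewrite mulry gtr0_sg// mul1e ltNge leey /=; split.
rewrite lee_fin => a0; rewrite -!EFinM -EFinB lte_fin.
have aE : (a * H s = 1 - q * a) <-> a = (H s + q)^-1.
  split=> [e|->]; last by field; rewrite lt0r_neq0.
  by apply: (mulIf (lt0r_neq0 G0)); rewrite mulVf ?lt0r_neq0//; lra.
split.
- case: ifPn => // qa1; rewrite inver gt_eqF ?subr_gt0// -EFinM => -[e].
  congr EFin; apply/aE.
  have q0 : 1 - q * a != 0 by rewrite lt0r_neq0// subr_gt0.
  apply: (mulfI (lt0r_neq0 p_gt0)).
  by move/eqP: e; rewrite eqr_div ?(lt0r_neq0 Hs)// => /eqP; rewrite mulrA.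
- move=> [/aE e].
  have a_gt0 : 0 < a by have /aE -> := e; rewrite invr_gt0.
  (* The solution automatically falls in the finite branch of [mgf_A1]. *)
  have qa : 0 < 1 - q * a by rewrite -e mulr_gt0.
  rewrite -subr_gt0 qa inver gt_eqF// -EFinM -e; congr EFin.
  by rewrite -/p; field; rewrite !lt0r_neq0.
Qed.

Lemma sub_Psi1E (s : R) : 0 <= s ->
  (s%:E - Psi1 A B s = s%:E - - mgf_inv ('M_P A) ((H s + q)^-1)%:E)%E.
Proof.
move=> s0; congr (_ - - _)%E; rewrite /mgf_inv; congr ereal_sup.
by apply/seteqP; split => _ [t /(mgf_A1_eq _ _ s0) ? <-]; exists t.
Qed.

Lemma sub_PsiE (s : R) : 0 <= s ->
  (s%:E - Psi A B s =
   s%:E - - mgf_inv ('M_P A) ((H s + q * expR (s * x))^-1)%:E)%E.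
Proof.
move=> s0; rewrite /Psi (mmt_gen_fun_atom P B x B_gt0 xE)// inver gt_eqF//.
rewrite ltr_wpDl ?mulr_gt0 ?expR_gt0//.
exact: truncated_mgf_ge0.
Qed.

Lemma endpoint_gt0 : 0 < x.
Proof.
have [w0 <-] : exists w, B w = x.
  apply: contrapT => NB; move: q_gt0.
  rewrite /q (_ : mkset _ = set0) ?measure0 ?ltxx//.
  by apply/seteqP; split => w //= Bw; apply: NB; exists w.
exact: B_gt0.
Qed.

(** For small [s] the product is at most [(1 - s c) (1 + s e b)], where [b = E B], [e = exp (s x)]
    and [e b < c < E A]. *)
Lemma exists_laplace_mgf_lt1 : ('E_P[B] < 'E_P[A])%E ->
  exists2 s, 0 < s & F s * (H s + q * expR (s * x)) < 1.
Proof.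
have p1 : p + q = 1 by exact: prob_below_endpoint.
rewrite (expectation_atom P B x B_gt0 xE); set b := _ + _ => bA.
have m0 : 0 < truncated_mean P B x by exact: truncated_mean_gt0.
have x0 := endpoint_gt0.
have b0 : 0 < b by rewrite addr_gt0// mulr_gt0.
have [c bc cA] : exists2 c, b < c & (c%:E < 'E_P[A])%E.
  case: ('E_P[A])%E bA => [a| |]// ba.
  - by exists ((b + a) / 2); move: ba; rewrite ?lte_fin; lra.
  - by exists (b + 1); rewrite ?ltry// ltrDl.
have : \forall n \near \oo, expR (harmonic n * x) * b < c.
  have : expR (harmonic n * x) * b @[n --> \oo] --> expR (0 * x) * b.
    apply: cvgM; last exact: cvg_cst.
    apply: continuous_cvg; first exact: continuous_expR.
    by apply: cvgM; [exact: cvg_harmonic|exact: cvg_cst].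
  by rewrite mul0r expR0 mul1r => /cvgr_lt; apply.
move=> near1; have near2 := laplace_slope P A A_ge0 c cA.
have [n _ /(_ n (leqnn _)) [eb Fc]] := filterI near1 near2.
have s0 : 0 < harmonic n :> R by exact: harmonic_gt0.
move: (harmonic n) s0 eb Fc => s s0 eb Fc; exists s => //.
have Hle := truncated_mgf_le P B x B_gt0 s (ltW s0).
have qle : q * expR (s * x) <= q * (1 + s * x * expR (s * x)).
  by rewrite ler_pM2l// expR_le1DMexpR.
set M := H s + _; set e := expR (s * x) in eb Hle qle *.
have Mle : M <= 1 + s * (e * b).
  apply: le_trans (lerD Hle qle) _; rewrite /b -/p -/q.
  have -> : p = 1 - q by rewrite -p1 addrK.
  by rewrite le_eqVlt; apply/orP; left; apply/eqP; ring.
have M0 : 0 <= M.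
  rewrite addr_ge0 ?mulr_ge0 ?expR_ge0// ?(ltW q_gt0)//.
  exact: truncated_mgf_ge0.
apply: le_lt_trans (ler_wpM2r M0 Fc) _.
have eb0 : 0 < e * b by rewrite mulr_gt0// expR_gt0.
(* If [s c > 1], the factor [1 - s c] is negative and the product is at most 0. *)
have [sc|sc] := leP (s * c) 1; last first.
  by apply: le_lt_trans ltr01; rewrite mulr_le0_ge0//; lra.
have sc0 : 0 <= 1 - s * c by rewrite subr_ge0.
apply: le_lt_trans (ler_wpM2l sc0 Mle) _.
have : 0 < s * (c - e * b) by rewrite mulr_gt0// subr_gt0.
have : 0 < s * c * (s * (e * b)).
  by apply: mulr_gt0; apply: mulr_gt0 => //; exact: lt_trans bc.
lra.
Qed.

Lemma gamma_lt (gp gv gw : R) : ('E_P[B] < 'E_P[A])%E ->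
  gp%:E = gamma_p A B -> gv%:E = gamma_v A B -> gw%:E = gamma_w A B ->
  gp < gv < gw.
Proof.
move=> BA gpE gvE gwE.
have p1 : p + q = 1 by exact: prob_below_endpoint.
have m0 : 0 < truncated_mean P B x by exact: truncated_mean_gt0.
pose G s := H s + q.
pose M s := H s + q * expR (s * x).
pose c s := q * (expR (s * x) - 1).
have x0 := endpoint_gt0.
have Gge s : 0 <= s -> 1 + s * truncated_mean P B x <= G s.
  move=> s0; have := truncated_mgf_ge P B x B_gt0 s s0.
  by rewrite /G -p1 -/p; lra.
have G_ge1 s : 0 <= s -> 1 <= G s.
  by move=> s0; apply: le_trans (Gge _ s0); rewrite lerDl mulr_ge0// ltW.
have G_gt1 s : 0 < s -> 1 < G s.
  by move=> s0; apply: lt_le_trans (Gge _ (ltW s0)); rewrite ltrDl mulr_gt0.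
have G_gt0 s : 0 <= s -> 0 < G s.
  by move=> s0; apply: lt_le_trans ltr01 (G_ge1 _ s0).
have G_ndecr s t : 0 <= s -> s <= t -> G s <= G t.
  by move=> s0 st; rewrite lerD2r truncated_mgf_ndecr.
have c_ndecr s t : 0 <= s -> s <= t -> c s <= c t.
  by move=> s0 st; rewrite ler_pM2l// lerD2r ler_expR ler_pM2r.
have c_gt0 s : 0 < s -> 0 < c s.
  by move=> s0; rewrite mulr_gt0// subr_gt0 expR_gt1 mulr_gt0.
have c_ge0 s : 0 <= s -> 0 <= c s.
  move=> s0; rewrite mulr_ge0 ?(ltW q_gt0)// subr_ge0 -expR0 ler_expR.
  by rewrite mulr_ge0// ltW.
have GM s : 0 <= s -> M s = G s + c s by move=> _; rewrite /M /G /c; ring.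
have M_ndecr s t : 0 <= s -> s <= t -> M s <= M t.
  move=> s0 st; rewrite !GM//; last exact: le_trans st.
  by apply: lerD; [exact: G_ndecr|exact: c_ndecr].
have M_ge1 s : 0 <= s -> 1 <= M s.
  by move=> s0; rewrite GM// (le_trans (G_ge1 _ s0))// lerDl c_ge0.
have M_gt0 s : 0 <= s -> 0 < M s.
  by move=> s0; apply: lt_le_trans ltr01 (M_ge1 _ s0).
have F0 := laplace0 P A.
have F_nincr := laplace_nincr P A A_ge0.
have F_modulus := laplace_modulus P A A_ge0.
have F_right0 := laplace_right0 P A A_ge0.
have le_gw s : 0 <= s -> F s * M s <= 1 -> s <= gw.
  move=> s0 FM; rewrite -lee_fin gwE; apply: ereal_sup_ubound; exists s => //=.
  by rewrite laplaceE// (mmt_gen_fun_atom P B x B_gt0 xE)// -EFinM lee_fin.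
have [s1 s10 FM1] := exists_laplace_mgf_lt1 BA.
have gw0 : 0 < gw by apply: lt_le_trans s10 (le_gw _ (ltW s10) (ltW FM1)).
(* As [F s1 < 1 / M s1], the solution [u] of [F u M s1 = 1] found in [[0, s1]] is not [s1], so
   [s1 - u] is a positive lower bound for [gp]. *)
have gp0 : 0 < gp.
  have [||u /andP[u0 us] Fu] :=
    ivt_of_modulus F F0 F_nincr F_modulus F_right0 s1 (M s1)^-1 (ltW s10).
  - by rewrite -[leRHS]mul1r ler_pdivlMr ?M_gt0 ?ltW.
  - by rewrite invf_le1 ?M_gt0 ?M_ge1 ?ltW.
  have FuM : F u * M s1 = 1 by rewrite Fu mulVf// lt0r_neq0// M_gt0// ltW.
  have : ((s1 - u)%:E <= gp%:E)%E.
    rewrite gpE.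
    apply: le_trans (le_sub_mgf_inv s1 _ _ (M_gt0 _ (ltW s10)) u0 FuM) _.
    by apply: ereal_sup_ubound; exists s1; rewrite ?sub_PsiE//= ltW.
  rewrite lee_fin; apply: lt_le_trans; rewrite subr_gt0 lt_neqAle us andbT.
  by apply/eqP => uE; move: FuM FM1; rewrite uE -/(M s1) => ->; rewrite ltxx.
have gp20 : 0 < gp / 2 by rewrite divr_gt0.
have le_gv s u : 0 <= s <= gw -> 0 <= u -> F u * G s = 1 -> s - u <= gv.
  move=> /andP[s0 sg] u0 Fu; rewrite -lee_fin gvE.
  apply: le_trans (le_sub_mgf_inv s _ _ (G_gt0 _ s0) u0 Fu) _.
  apply: ereal_sup_ubound; exists s; last by rewrite sub_Psi1E.
  by rewrite /= -gwE !lee_fin s0.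
apply/andP; split.
- have [dl dl0 gap] := busy_sojourn_gap F F0 F_nincr F_modulus F_right0 G M gw
    G_gt0 G_gt1 gw0 c c_gt0 c_ndecr M_ndecr GM _ gp20.
  (* Pairs with [s - u <= gp / 2] cannot reach the supremum [gp > 0]; all others stay below
     [gv - dl], which therefore bounds [gp]. *)
  have : (gp%:E <= (Num.max (gp / 2) (gv - dl))%:E)%E.
    rewrite gpE; apply: ge_ereal_sup => _ [s /= s0 <-]; rewrite sub_PsiE//.
    apply: sub_mgf_inv_le; first exact: M_ge1.
    move=> u u0 FM; rewrite le_max; have [//|gs] := leP (s - u) (gp / 2).
    have us : u <= s by lra.
    have sg : s <= gw.
      by apply: le_gw => //; rewrite -FM ler_pM2r ?M_gt0 ?F_nincr.
    have [v /andP[v0 vu] Fv] := gap s u u0 sg (ltW gs) FM.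
    have := le_gv s v; rewrite s0 sg => /(_ isT v0 Fv) sv.
    by apply/orP; right; lra.
  by rewrite lee_fin le_max => /orP[]; lra.
- have [dl dl0 gap] := sojourn_workload_gap F F0 F_nincr F_modulus F_right0 G gw
    G_gt0 G_ndecr G_gt1 gw0.
  have : (gv%:E <= (gw - dl)%:E)%E.
    rewrite gvE; apply: ge_ereal_sup => _ [s /= + <-].
    rewrite -gwE !lee_fin => sg; have /andP[s0 _] := sg.
    rewrite sub_Psi1E//; apply: sub_mgf_inv_le; first exact: G_ge1.
    by move=> u u0 Fu; exact: gap.
  by rewrite lee_fin; lra.
Qed.

End formulas.

(** * From the queueing hypotheses to the inequalities between the formulas *)

Theorem corollary5p2 (R : realType) (d : measure_display)
  (T : measurableType d) (P : probability T R)
  (A B : nat -> {RV P >-> R})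
  (A_ge0 : forall n w, 0 <= A n w)
  (B_gt0 : forall n w, 0 < B n w)
  (indep : mutually_independent
     (fun k : nat + nat => match k with inl n => A n | inr n => B n end))
  (A_id : identically_distributed A)
  (B_id : identically_distributed B)
  (rho_lt1 : (load (A 0%N) (B 0%N) < 1)%E)
  (B_gt_A : (0 < P [set w | (A 0%N w < B 0%N w)%R])%E)
  (B_light : light_tailed (B 0%N))
  (atom_gt0 : (0 < P [set w | (B 0%N w)%:E = right_endpoint (B 0%N)])%E)
  (atom_lt1 : (P [set w | (B 0%N w)%:E = right_endpoint (B 0%N)] < 1)%E)
  (* steady-state workload at arrivals and SRPT sojourn time *)
  (W V : {RV P >-> R})
  (W_steady : steady_state
     (fun n w => (workload (A ^~ w) (B ^~ w) n)%:E) W)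
  (V_steady : steady_state
     (fun n w => srpt_sojourn (A ^~ w) (B ^~ w) n) V)
  (* the decay rates ... *)
  (gp gv gw : R)
  (decay_p : decay_rate P (fun w => busy_period (A ^~ w) (B ^~ w)) gp)
  (decay_v : decay_rate P (fun w => (V w)%:E) gv)
  (decay_w : decay_rate P (fun w => (W w)%:E) gw)
  (* ... are given by the known formulas *)
  (gpE : gp%:E = gamma_p (A 0%N) (B 0%N))
  (gvE : gv%:E = gamma_v (A 0%N) (B 0%N))
  (gwE : gw%:E = gamma_w (A 0%N) (B 0%N)) :
  gp < gv < gw.
Proof.
have EB_ge0 : (0 <= 'E_P[B 0%N])%E.
  by rewrite expectation.unlock integral_ge0// => w _; rewrite lee_fin ltW.
have EA_ge0 : (0 <= 'E_P[A 0%N])%E.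
  by rewrite expectation.unlock integral_ge0// => w _; rewrite lee_fin.
(* The atom has positive probability, hence is nonempty, so the right endpoint is a value of [B] and
   is finite. *)
have [w0 xE] : exists w, right_endpoint (B 0%N) = (B 0%N w)%:E.
  apply: contrapT => NB; move: atom_gt0.
  rewrite (_ : mkset _ = set0) ?measure0 ?ltxx//.
  by apply/seteqP; split => w //= Bw; apply: NB; exists w.
move: (B 0%N w0) xE => x xE.
have EBE := expectation_atom P (B 0%N) x (B_gt0 0%N) xE.
have atomE : [set w | (B 0%N w)%:E = right_endpoint (B 0%N)] =
             [set w | B 0%N w = x].
  by apply/seteqP; split => w /=; rewrite xE; [case|move->].
have mE := measurable_rv_eq P (B 0%N) x.
have p1 := prob_below_endpoint P (B 0%N) x (B_gt0 0%N) xE.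
have q_gt0 : 0 < fine (P [set w | B 0%N w = x]).
  by rewrite -lte_fin fineK ?fin_num_measure// -atomE.
have q_lt1 : fine (P [set w | B 0%N w = x]) < 1.
  by rewrite -lte_fin fineK ?fin_num_measure// -atomE.
have p_gt0 : 0 < fine (P [set w | B 0%N w < x]) by lra.
have EB_gt0 : (0 < 'E_P[B 0%N])%E.
  have PT : (0 < P [set: T])%E by rewrite probability_setT.
  by rewrite expectation.unlock integral_pos_gt0.
(* If [E A = 0], its inverse is [+oo] and so is the load, which is excluded; if [E A = +oo],
   finiteness of [E B] suffices. *)
have EBA : ('E_P[B 0%N] < 'E_P[A 0%N])%E.
  move: rho_lt1 EB_gt0 EA_ge0; rewrite /load EBE; set b := _ + _.
  case: ('E_P[A 0%N])%E => [a| |]//; last by rewrite ltry.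
  rewrite !lee_fin !lte_fin inver => + b0 a0; case: eqP => [_|/eqP aN0].
    by rewrite gt0_muley// lte_fin.
  by rewrite -EFinM lte_fin ltr_pdivrMr ?mul1r// lt_neqAle eq_sym aN0.
apply: (@gamma_lt _ _ _ P (A 0%N) (B 0%N) x) => //.
exact: le_lt_trans EBA.
Qed.
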